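(* Let $K$ be a convex polygonal line embedded into $\mathbb{R}^d$ with nodes (vertices) $x_1,\dots,x_k\in\mathbb{R}^d$, listed in order along $K$, and let $n$ be a nonnegative integer. Let $f_1,\dots,f_k$ be real numbers, not all zero, such that $$\sum_{i=1}^k P(x_i)f_i=0$$ for every real polynomial $P$ in $d$ variables of degree not higher than $n$. Then the sequence $f_1,f_2,\dots,f_k$ changes sign at least $dn+1$ times if $K$ is not closed, and at least $dn+2$ times if $K$ is closed.
   Context: A polygonal line $K$ in $\mathbb{R}^d$ is convex if every hyperplane (affine subspace of dimension $d-1$) which does not pass through the vertices of $K$ cuts $K$ at no more than $d$ points. The number of sign changes of $f_1,\dots,f_k$ is the number of sign changes between consecutive terms after zero terms are deleted; if $K$ is closed, the sequence is regarded as cyclic (the last nonzero term is also followed by the first).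
   Formalization: For n ≥ 1 the nodes are also assumed in general position (any at most d+1 of them affinely independent); without this the claim fails, e.g. d=2, n=1, open line with nodes (0,0),(1,0),(2,0) and f=(1,−2,1), which has only 2 sign changes. *)

(* Defs.v *)
From mathcomp Require Import all_boot all_order all_algebra.
From mathcomp Require Export mpoly.

Set Implicit Arguments.
Unset Strict Implicit.
Unset Printing Implicit Defensive.

Import Order.TTheory GRing.Theory Num.Theory.
Local Open Scope ring_scope.

(* A polygonal line is given by its nodes [x], in order, and by the flag
   [closed].  It is parametrized by pairs [(i, t)] with [0 <= t < 1]: the pair
   stands for the point at ratio [t] on the edge that leaves the node [i].  The
   last node, whose cyclic successor is the first one, has an outgoing edge
   only if the line is closed, otherwise only [t = 0] is allowed there.  So
   the parameters form a segment, or a circle if the line is closed. *)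
Definition has_edge (k : nat) (closed : bool) (i : 'I_k) : bool :=
  closed || (i.+1 < k)%N.

Definition line_param (R : realFieldType) (k : nat) (closed : bool)
    (u : 'I_k * R) : bool :=
  (0 <= u.2 < 1) && ((u.2 == 0) || has_edge closed u.1).

Definition line_point (R : realFieldType) (d k : nat) (x : 'I_k -> 'rV[R]_d)
    (u : 'I_k * R) : 'rV[R]_d :=
  (1 - u.2) *: x u.1 + u.2 *: x (ordS u.1).

Definition on_line (R : realFieldType) (d k : nat) (closed : bool)
    (x : 'I_k -> 'rV[R]_d) (p : 'rV[R]_d) : Prop :=
  exists2 u : 'I_k * R, line_param closed u & p = line_point x u.

Definition embedded_line (R : realFieldType) (d k : nat) (closed : bool)
    (x : 'I_k -> 'rV[R]_d) : Prop :=
  forall u v : 'I_k * R, line_param closed u -> line_param closed v ->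
    line_point x u = line_point x v -> u = v.

(* The affine subspace through [q] directed by the row space of [V]. *)
Definition affine_subspace (R : realFieldType) (d : nat) (q : 'rV[R]_d)
    (V : 'M[R]_d) : pred 'rV[R]_d :=
  fun p => (p - q <= V)%MS.

Definition convex_line (R : realFieldType) (d k : nat) (closed : bool)
    (x : 'I_k -> 'rV[R]_d) : Prop :=
  forall (q : 'rV[R]_d) (V : 'M[R]_d), (\rank V).+1 = d ->
    (forall i, ~~ affine_subspace q V (x i)) ->
    forall s : seq 'rV[R]_d, uniq s ->
      (forall p, p \in s -> on_line closed x p /\ affine_subspace q V p) ->
      (size s <= d)%N.

(* Any at most [d + 1] of the points are affinely independent.  Convexity does
   not imply this, since it only restricts the hyperplanes that avoid the
   nodes: for instance, the non-closed line with nodes (0,0), (1,0), (2,0) is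
   convex in the plane. *)
Definition general_position (R : realFieldType) (d k : nat)
    (x : 'I_k -> 'rV[R]_d) : Prop :=
  forall (A : {set 'I_k}) (c : 'I_k -> R), (#|A| <= d.+1)%N ->
    \sum_(i in A) c i = 0 -> \sum_(i in A) c i *: x i = 0 ->
    forall i, i \in A -> c i = 0.

Definition nonzero_terms (R : realFieldType) (k : nat) (f : 'I_k -> R) : seq R :=
  [seq y <- codom f | y != 0].

Definition opposite_signs (R : realFieldType) (p : R * R) : bool :=
  p.1 * p.2 < 0.

Definition sign_changes (R : realFieldType) (k : nat) (f : 'I_k -> R) : nat :=
  let s := nonzero_terms f in count (@opposite_signs R) (zip s (behead s)).

Definition cyclic_sign_changes (R : realFieldType) (k : nat)
    (f : 'I_k -> R) : nat :=
  let s := nonzero_terms f in count (@opposite_signs R) (zip s (rot 1 s)).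

(* Main.v *)
(* By general position some affine function vanishes at exactly [d] prescribed
   nodes, and a perturbation gives it arbitrary signs there.  Convexity allows
   at most [d] sign changes along the nodes, and if the signs at the zeros are
   chosen so that each zero produces a change, this bound is attained.  That
   determines the signs off the zeros, so every sign sequence with at most [d]
   changes is the sign sequence of an affine function on the nodes.  If [f]
   changed sign at most [d * n] times, a product of [n] such functions would
   have the sign of [f] at every node where [f] is nonzero, contradicting the
   moment condition of degree [n].  On a closed line cyclic sign changes are
   even in number; applied to an affine function with [d] changes this makes
   [d] even, and applied to [f] it turns [d * n + 1] into [d * n + 2]. *)
Require Import Defs.
From mathcomp Require Import all_boot all_order all_algebra.
From mathcomp Require Import zify ring lra.
Import Order.TTheory GRing.Theory Num.Theory.
Local Open Scope ring_scope.

Set Implicit Arguments.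
Unset Strict Implicit.
Unset Printing Implicit Defensive.

(** * Affine functions on a polygonal line and on its nodes *)

Definition aff {R : realFieldType} {d : nat} (w : R * 'cV[R]_d)
    (p : 'rV[R]_d) : R :=
  w.1 + (p *m w.2) 0 0.

Lemma affB (R : realFieldType) (d : nat) (w : R * 'cV[R]_d) (p q : 'rV[R]_d) :
  aff w p - aff w q = ((p - q) *m w.2) 0 0.
Proof. by rewrite /aff mulmxBl !mxE; ring. Qed.

Lemma aff_line_point (R : realFieldType) (d k : nat) (w : R * 'cV[R]_d)
    (x : 'I_k -> 'rV[R]_d) (u : 'I_k * R) :
  aff w (line_point x u) =
  (1 - u.2) * aff w (x u.1) + u.2 * aff w (x (ordS u.1)).
Proof. by rewrite /aff /line_point mulmxDl -!scalemxAl !mxE; ring. Qed.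

Lemma aff_linear (R : realFieldType) (d : nat) (a : R) (w w' : R * 'cV[R]_d)
    (p : 'rV[R]_d) :
  aff (a * w.1 + w'.1, a *: w.2 + w'.2) p = a * aff w p + aff w' p.
Proof. by rewrite /aff /= mulmxDr -scalemxAr !mxE; ring. Qed.

Definition crossings {R : realFieldType} {k : nat} (closed : bool)
    (g : 'I_k -> R) : {set 'I_k} :=
  [set i | has_edge closed i && (g i * g (ordS i) < 0)].

(** Each edge whose ends lie strictly on opposite sides meets the zero hyperplane; embeddedness
    makes these points distinct, so convexity bounds their number. *)
Lemma convex_line_crossings (R : realFieldType) (d k : nat) (closed : bool)
    (x : 'I_k -> 'rV[R]_d) (w : R * 'cV[R]_d) :
    embedded_line closed x -> convex_line closed x ->
    (forall i, aff w (x i) != 0) ->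
  (#|crossings closed (fun i => aff w (x i))| <= d)%N.
Proof.
move=> x_emb x_conv w_neq0; set g := fun i => _; set S := crossings _ _.
have [-> | [i0 i0S]] := set_0Vmem S; first by rewrite cards0.
(* For a crossing edge, the ratio at which the affine function vanishes on it. *)
pose t i := g i / (g i - g (ordS i)).
have crossP i : i \in S -> [/\ has_edge closed i, 0 <= t i < 1 &
    aff w (line_point x (i, t i)) = 0].
  rewrite inE => /andP[edge_i lt0]; split=> //; last first.
    rewrite aff_line_point /= -/(g i) -/(g (ordS i)) /t; field.
    rewrite subr_eq0; apply: contraTneq lt0 => ->.
    by rewrite -leNgt -expr2 sqr_ge0.
  rewrite /t; have [gi|gi] := ltP 0 (g i).
    have gj : g (ordS i) < 0 by rewrite pmulr_rlt0 in lt0.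
    have gij : 0 < g i - g (ordS i) by lra.
    by rewrite divr_ge0 ?ltW //= ltr_pdivrMr //; lra.
  have {}gi : g i < 0 by rewrite lt_neqAle gi w_neq0.
  have gj : 0 < g (ordS i) by rewrite nmulr_rlt0 in lt0.
  have gij : g i - g (ordS i) < 0 by lra.
  rewrite ltr_ndivrMr // mul1r; apply/andP; split; last lra.
  by rewrite mulr_le0 ?invr_le0 ?ltW.
pose q := line_point x (i0, t i0).
(* A constant function has no crossing, so the kernel of [w.2] directs a genuine hyperplane. *)
have w2_neq0 : w.2 != 0.
  apply: contraTneq i0S => w2_eq0; rewrite inE /g /aff w2_eq0 !mulmx0 !mxE.
  by rewrite negb_and -leNgt -expr2 sqr_ge0 orbT.
have hyperE p : affine_subspace q (kermx w.2) p = (aff w p == 0).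
  have [_ _ q0] := crossP _ i0S.
  rewrite /affine_subspace sub_kermx -[aff w p]subr0 -q0 affB.
  apply/eqP/eqP => [-> | eq0]; first by rewrite mxE.
  by apply/rowP=> i; rewrite !ord1 eq0 mxE.
have rankV : (\rank (kermx w.2)).+1 = d.
  have rk1 : \rank w.2 = 1%N.
    by rewrite -mxrank_tr rank_rV trmx_eq0 w2_neq0.
  rewrite mxrank_ker rk1; have := rank_leq_row w.2; rewrite rk1; lia.
rewrite cardE -(size_map (fun i => line_point x (i, t i))).
apply: (x_conv q _ rankV) => [i||p]; first by rewrite hyperE.
  rewrite map_inj_in_uniq ?enum_uniq // => i j.
  rewrite !mem_enum => /crossP[ei ti _] /crossP[ej tj _] /x_emb.
  by rewrite /line_param /= ei ej ti tj !orbT => /(_ isT isT) [].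
case/mapP=> i; rewrite mem_enum => /crossP[ei ti w0] ->; split.
  by exists (i, t i); rewrite // /line_param /= ei ti orbT.
by rewrite hyperE w0.
Qed.

(* In homogeneous coordinates the [d + 1] nodes form an invertible matrix. *)
Lemma general_position_interpolation (R : realFieldType) (d k : nat)
    (x : 'I_k -> 'rV[R]_d) (A : {set 'I_k}) :
    general_position x -> #|A| = d.+1 ->
  (forall y : 'I_k -> R, exists w, {in A, forall i, aff w (x i) = y i}) /\
  (forall w, {in A, forall i, aff w (x i) = 0} -> forall p, aff w p = 0).
Proof.
move=> gp cardA; pose g (i : 'I_(1 + d)) := enum_val (cast_ord (esym cardA) i).
have gA i : g i \in A by exact: enum_valP.
have g_inj : injective g.
  by move=> i j eq_ij; apply/(@cast_ord_inj _ _ (esym cardA))/enum_val_inj.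
have g_onto i : i \in A -> exists j, g j = i.
  move=> iA; exists (cast_ord cardA (enum_rank_in iA i)).
  by rewrite /g cast_ordK enum_rankK_in.
pose M : 'M[R]_(1 + d) := \matrix_i row_mx 1 (x (g i)).
have M_aff w i : (M *m col_mx w.1%:M w.2) i 0 = aff w (x (g i)).
  rewrite -[LHS](_ : row i (M *m col_mx w.1%:M w.2) 0 0 = _); last first.
    by rewrite mxE.
  by rewrite row_mul rowK mul_row_col mul1mx /aff !mxE eqxx.
have M_unit : M \in unitmx.
  rewrite -row_free_unit; apply: inj_row_free => v vM0.
  have sumA (V : zmodType) (F : 'I_k -> V) : \sum_(i in A) F i = \sum_j F (g j).
    rewrite -(big_imset _ (in2W g_inj)) /=; apply: eq_bigl => i.
    apply/idP/imsetP => [/g_onto[j <-] | [j _ ->]]; last exact: gA.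
    by exists j.
  (* [c] carries the row coefficients over to node indices; the first column of [M] gives their zero
     sum, the other columns the zero combination of nodes. *)
  pose c i := \sum_(j | g j == i) v 0 j.
  have cg j : c (g j) = v 0 j.
    by rewrite /c (big_pred1 j) // => j'; exact: inj_eq.
  move: vM0; rewrite mulmx_sum_row => vM0.
  have {}vM0 : \sum_j v 0 j *: row_mx 1 (x (g j)) = 0 :> 'rV_(1 + d).
    by rewrite -[RHS]vM0; apply: eq_bigr => j _; rewrite rowK.
  apply/rowP => j; rewrite mxE -cg.
  apply: (gp A) (gA j); first by rewrite cardA.
    rewrite sumA; move/(congr1 (fun u : 'rV_(1 + d) => u 0 (lshift d 0))): vM0.
    rewrite summxE mxE => {2}<-; apply: eq_bigr => i _.
    by rewrite cg mxE row_mxEl mxE mulr1.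
  rewrite sumA; move/(congr1 (@rsubmx _ 1 1 d)): vM0.
  rewrite linear_sum linear0 => {2}<-; apply: eq_bigr => i _.
  by rewrite cg linearZ /= row_mxKr.
split=> [y | w w0 p].
  pose W := invmx M *m \col_i y (g i).
  exists (usubmx W 0 0, dsubmx W) => i /g_onto[j <-].
  rewrite -M_aff /= -mx11_scalar vsubmxK mulKVmx // mxE //.
have : M *m col_mx w.1%:M w.2 = 0.
  by apply/colP => i; rewrite M_aff w0 ?mxE.
move/(congr1 (mulmx (invmx M))); rewrite mulKmx // mulmx0.
rewrite -[RHS](@col_mx0 _ 1 d 1).
case/eq_col_mx=> /(congr1 (fun u : 'M_1 => u 0 0)); rewrite !mxE eqxx => w1 w2.
by rewrite /aff w2 mulmx0 mxE addr0.
Qed.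

(** * Sign patterns of affine functions on the nodes *)

(** The value [true] stands for a negative sign; zero values are excluded. *)
Definition sign_pattern {R : realFieldType} {d k : nat} (x : 'I_k -> 'rV[R]_d)
    (s : 'I_k -> bool) : Prop :=
  exists w, forall i, 0 < (-1) ^+ s i * aff w (x i).

Lemma sign_pattern_flip (R : realFieldType) (d k : nat) (x : 'I_k -> 'rV[R]_d)
    (b : bool) (s : 'I_k -> bool) :
  sign_pattern x (fun i => b (+) s i) -> sign_pattern x s.
Proof.
case=> w w_gt0; exists ((-1) ^+ b * w.1 + 0, (-1) ^+ b *: w.2 + 0) => i.
rewrite (aff_linear _ w (0, 0)) {2}/aff /= mulmx0 mxE !addr0 mulrA -signr_addb.
by rewrite addbC.
Qed.

Lemma sign_pattern_perturb (R : realFieldType) (d k : nat)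
    (x : 'I_k -> 'rV[R]_d) (Z : {set 'I_k}) :
    general_position x -> #|Z| = d -> (d < k)%N ->
  exists s : 'I_k -> bool, forall t : 'I_k -> bool,
    (forall i, i \notin Z -> t i = s i) -> sign_pattern x t.
Proof.
move=> gp cardZ dk.
have cardU i : i \notin Z -> #|i |: Z| = d.+1 by rewrite cardsU1 cardZ => ->.
have [j jZ] : exists j, j \notin Z.
  apply/existsP; rewrite -negb_forall; apply: contraL dk => /forallP Zall.
  rewrite -leqNgt -cardZ -[k in (k <= _)%N]card_ord.
  by apply/subset_leq_card/subsetP => i _; exact: Zall.
have jA : j \in j |: Z by rewrite setU11.
have ZA i : i \in Z -> i \in j |: Z by move=> iZ; rewrite inE iZ orbT.
have [interp _] := general_position_interpolation gp (cardU j jZ).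
have [w0 w0E] := interp (fun i => (i == j)%:R).
have w0Z i : i \in Z -> aff w0 (x i) = 0.
  by move=> iZ; rewrite w0E ?ZA //; case: eqP iZ jZ => // -> ->.
(* Another zero would make [w0] vanish at [d + 1] nodes, hence everywhere, against its value 1 at
   [x j]. *)
have w0_neq0 i : i \notin Z -> aff w0 (x i) != 0.
  move=> /cardU/(general_position_interpolation gp)[_ uniq_w].
  apply/eqP => w0i; suff: aff w0 (x j) = 0.
    by rewrite w0E // eqxx => /eqP; rewrite oner_eq0.
  by apply: uniq_w => i'; rewrite !inE => /predU1P[-> //|/w0Z].
exists (fun i => aff w0 (x i) < 0) => t tE.
have [h hE] := interp (fun i => (-1) ^+ t i).
(* [N] exceeds each of these ratios off [Z], so [N * w0] dominates [h] there; on [Z] the quotients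
   are 0 by the convention for division by zero. *)
pose N := 1 + \sum_i `|aff h (x i)| / `|aff w0 (x i)|.
exists (N * w0.1 + h.1, N *: w0.2 + h.2) => i; rewrite aff_linear.
have [iZ | iZ] := boolP (i \in Z).
  by rewrite w0Z // mulr0 add0r hE ?ZA // -signr_addb addbb.
have l_gt0 : 0 < `|aff w0 (x i)| by rewrite normr_gt0 w0_neq0.
have {}l_gt0 : `|aff h (x i)| < N * `|aff w0 (x i)|.
  rewrite -ltr_pdivrMr // /N (bigD1 i) //=.
  rewrite -subr_gt0 addrA addrAC addrK ltr_wpDr //.
  by apply: sumr_ge0 => *; rewrite divr_ge0.
have absE : (-1) ^+ (aff w0 (x i) < 0)%R * aff w0 (x i) = `|aff w0 (x i)|.
  by case: ltrP => [/ltr0_norm->|/ger0_norm->]; rewrite ?mulN1r ?mul1r.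
rewrite tE // mulrDr mulrCA absE.
have := ler_norm (- ((-1) ^+ (aff w0 (x i) < 0)%R * aff h (x i))).
by rewrite normrN normrM normr_sign mul1r; lra.
Qed.

(** Models a running count of sign changes, whose parity encodes the current sign. *)
Definition unit_steps (c : nat -> nat) : Prop :=
  c 0%N = 0%N /\ forall i, (c i <= c i.+1 <= (c i).+1)%N.

Lemma unit_steps_sum (c : nat -> nat) (m : nat) :
  unit_steps c -> (\sum_(i < m) (c i.+1 != c i))%N = c m.
Proof.
case=> c0 c_step; elim: m => [|m IHm]; first by rewrite big_ord0.
rewrite big_ord_recr /= IHm; have := c_step m; case: eqP; lia.
Qed.

Lemma sign_pattern_changes (R : realFieldType) (d k : nat) (closed : bool)
    (x : 'I_k.+1 -> 'rV[R]_d) (s : nat -> bool) :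
    embedded_line closed x -> convex_line closed x -> sign_pattern x s ->
  (\sum_(i < k) (s i (+) s i.+1) + (closed && (s k (+) s 0)) <= d)%N.
Proof.
move=> x_emb x_conv [w w_gt0].
have w_neq0 i : aff w (x i) != 0.
  by have := w_gt0 i; apply: contraTneq => ->; rewrite mulr0 ltxx.
apply: leq_trans (convex_line_crossings x_emb x_conv w_neq0).
have changeE i j : (aff w (x i) * aff w (x j) < 0) = (s i (+) s j).
  have: 0 < (-1) ^+ (s i (+) s j) * (aff w (x i) * aff w (x j)).
    by rewrite signr_addb mulrACA mulr_gt0.
  by case: (_ (+) _); rewrite ?mulN1r ?mul1r ?oppr_gt0 // => /lt_gtF.
rewrite -sum1_card [leqRHS]big_mkcond [leqRHS]big_ord_recr /=; apply: leq_add.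
  apply: leq_sum => i _; rewrite inE changeE /has_edge /=.
  rewrite modn_small ltnS ?ltn_ord //.
  by rewrite orbT; case: (_ (+) _).
by rewrite inE changeE /has_edge /= modnn ltnn orbF; case: (_ && _).
Qed.

(** The signs of [s] are prescribed only away from the [d] jumps of [e]; at the jumps a perturbation
    realizes any choice. *)
Lemma sign_pattern_jumps (R : realFieldType) (d k : nat) (closed : bool)
    (x : 'I_k.+1 -> 'rV[R]_d) (e : nat -> nat) (s : nat -> bool) :
    embedded_line closed x -> convex_line closed x -> general_position x ->
    unit_steps e -> e k = d -> (d <= k)%N ->
    (forall i, (i <= k)%N -> e i = e i.-1 -> s i = odd (e i)) ->
  sign_pattern x s.
Proof.
move=> x_emb x_conv gp e_unit ek dk sE.
(* Since [0.-1] is [0], the first node never lies in [Z]. *)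
pose Z := [set i : 'I_k.+1 | e i != e i.-1].
have cardZ : #|Z| = d.
  rewrite -sum1_card big_mkcond big_ord_recl inE eqxx /= add0n.
  rewrite -ek -(unit_steps_sum _ e_unit).
  by apply: eq_bigr => i _; rewrite inE /=; case: eqP.
have [s0 s0P] := sign_pattern_perturb gp cardZ dk.
(* The number of changes of [t] is at least the number of jumps of [e], which is
   the largest possible one, so [t] changes only at the jumps. *)
pose fix t m := if m is m'.+1 then
  if e m'.+1 == e m' then s0 (inord m) else ~~ t m' else s0 ord0.
have tE (i : 'I_k.+1) : i \notin Z -> t i = s0 i.
  rewrite inE negbK; case: i => [[|m] lt_mk] /= => [_ | ->].
    by congr s0; apply/val_inj.
  by congr s0; apply/val_inj; rewrite /= inordK.
have := sign_pattern_changes x_emb x_conv (s0P t tE).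
move/(leq_trans (leq_addr _ _)); rewrite -{1}ek -unit_steps_sum //.
have t_jump i : (e i.+1 != e i) -> t i (+) t i.+1.
  by rewrite /=; case: eqP => //=; case: (t i).
have le_jump (i : 'I_k) : true -> ((e i.+1 != e i) <= t i (+) t i.+1
    ?= iff ((e i.+1 != e i) == (t i (+) t i.+1) :> nat))%N.
  by move=> _; apply: leqif_eq; have := t_jump i; case: (e _ != _) => // ->.
(* Equal sums with termwise inequality force equality in each term. *)
rewrite (geq_leqif (leqif_sum le_jump)) => /forallP/= changeE.
apply: (sign_pattern_flip (b := t 0%N)); apply: s0P => i iZ.
have -> : s i = odd (e i).
  by apply: sE; [rewrite -ltnS | move: iZ; rewrite inE negbK => /eqP].
rewrite -(tE i iZ); case: i {iZ} => m /=; rewrite ltnS.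
elim: m => [|m IHm] lt_mk; first by rewrite e_unit.1 addbF.
have -> : t m.+1 = t m (+) (e m.+1 != e m).
  have := changeE (Ordinal lt_mk); rewrite /=.
  by case: (e _ == _) => /=; [case: (s0 _) |]; case: (t m).
rewrite -(IHm (ltnW lt_mk)); have := e_unit.2 m.
case: eqP => [-> | neq_e e_m]; first by rewrite addbF.
have -> : e m.+1 = (e m).+1 by lia.
by rewrite /= -addbA addbT.
Qed.

Lemma sign_pattern_levels (R : realFieldType) (d k : nat) (closed : bool)
    (x : 'I_k.+1 -> 'rV[R]_d) (c : nat -> nat) :
    embedded_line closed x -> convex_line closed x -> general_position x ->
    (d <= k)%N -> unit_steps c -> (forall i, c i <= d)%N ->
  sign_pattern x (fun i => odd (c i)).
Proof.
move=> x_emb x_conv gp dk [c0 c_step] c_le.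
(* Padding [c] with steps at the end brings the number of steps to [d]. *)
pose e i := maxn (c i) (i + d - k).
apply: (sign_pattern_jumps (e := e) (s := fun i => odd (c i)) x_emb x_conv gp).
- by split=> [|i]; rewrite /e; [lia | have := c_step i; lia].
- by rewrite /e; have := c_le k; lia.
- by [].
(* Where the padding exceeds [c] it grows at every step, so [e] equals [c] wherever [e] does not
   jump. *)
case=> [|i] i_le; rewrite /e /=; first by move=> _; congr odd; lia.
by move=> e_eq; congr odd; have := c_step i; lia.
Qed.

(** Alternate signs over the first [d] edges and keep them constant afterwards: for odd [d] the
    closing edge would add a change beyond [d]. *)
Lemma closed_convex_line_even (R : realFieldType) (d k : nat)
    (x : 'I_k.+1 -> 'rV[R]_d) :
    embedded_line true x -> convex_line true x -> general_position x ->
    (d <= k)%N ->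
  ~~ odd d.
Proof.
move=> x_emb x_conv gp dk; pose e i := minn i d.
have e_unit : unit_steps e by split=> [|i]; rewrite /e; lia.
have ek : e k = d by rewrite /e; lia.
have := sign_pattern_levels x_emb x_conv gp dk e_unit (fun i => geq_minr _ _).
move/(sign_pattern_changes (s := odd \o e) x_emb x_conv) => /=.
rewrite (eq_bigr (fun i : 'I_k => (e i.+1 != e i) : nat)) => [|i _].
  rewrite unit_steps_sum // ek /e min0n; case: (odd d) => //.
  by rewrite addn1 ltnn.
by have := e_unit.2 i; case: eqP => [-> | ne le];
  [rewrite addbb | have -> : e i.+1 = (e i).+1 by lia]; rewrite //= addbN addbb.
Qed.

(** * Products of affine functions as polynomials *)

Definition aff_mpoly {R : realFieldType} {d : nat} (w : R * 'cV[R]_d) :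
    {mpoly R[d]} :=
  w.1%:MP + \sum_j w.2 j 0 *: 'X_j.

Lemma meval_aff_mpoly (R : realFieldType) (d : nat) (w : R * 'cV[R]_d)
    (p : 'rV[R]_d) :
  (aff_mpoly w).@[p ord0] = aff w p.
Proof.
rewrite /aff_mpoly /aff mevalD mevalC raddf_sum mxE; congr (_ + _).
by apply: eq_bigr => j _; rewrite /= mevalZ mevalXU mulrC.
Qed.

Lemma msize_aff_mpoly (R : realFieldType) (d : nat) (w : R * 'cV[R]_d) :
  (msize (aff_mpoly w) <= 2)%N.
Proof.
apply: leq_trans (mmeasureD_le _ _ _) _; rewrite geq_max mmeasureC.
rewrite (leq_trans (leq_b1 _)) //=; apply: leq_trans (mmeasure_sum _ _ _ _) _.
apply/bigmax_leqP => j _.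
by apply: leq_trans (msizeZ_le _ _) _; rewrite msizeX mdeg1.
Qed.

Lemma sign_pattern_prod (R : realFieldType) (d k n : nat) (x : 'I_k -> 'rV[R]_d)
    (c : nat -> nat -> nat) :
    (forall m, (m < n)%N -> sign_pattern x (fun i => odd (c m i))) ->
  exists2 P : {mpoly R[d]}, (msize P <= n.+1)%N &
    forall i : 'I_k, 0 < (-1) ^+ (\sum_(m < n) c m i)%N * P.@[x i ord0].
Proof.
elim: n => [|n IHn] c_pat.
  exists 1; first by rewrite msize1.
  by move=> i; rewrite big_ord0 meval1 mulr1.
have [|P P_size P_gt0] := IHn; first by move=> m /leqW; exact: c_pat.
have [w w_gt0] := c_pat n (ltnSn n).
exists (P * aff_mpoly w) => [|i].
  have [->|w_neq0] := eqVneq (aff_mpoly w) 0; first by rewrite mulr0 msize0.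
  have [->|P_neq0] := eqVneq P 0; first by rewrite mul0r msize0.
  rewrite msizeM // -ltnS prednK; last first.
    by rewrite addn_gt0 lt0n msize_poly_eq0 P_neq0.
  by rewrite -addn2 leq_add // msize_aff_mpoly.
rewrite big_ord_recr /= exprD mevalM meval_aff_mpoly mulrACA.
by rewrite mulr_gt0 // -signr_odd.
Qed.

(** * Levels and parity of sign changes *)

(* Cuts a level function of height at most [d * n] into [n] of height [d]. *)
Lemma sum_minn_subn (d n a : nat) :
  (\sum_(m < n) minn d (a - d * m) = minn a (d * n))%N.
Proof.
elim: n => [|n IHn]; first by rewrite big_ord0 muln0 minn0.
by rewrite big_ord_recr /= IHn mulnS; lia.
Qed.

(* [c i] counts the sign changes of [u] up to the index [i]. *)
Lemma sign_levels (R : realFieldType) (u : seq R) :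
  let s := [seq y <- u | y != 0] in
  exists c, [/\ unit_steps c,
    forall i, (c i <= count (@opposite_signs R) (zip s (behead s)))%N &
    forall i, 0 <= (-1) ^+ ((head 0 s < 0)%R + c i)%N * u`_i].
Proof.
elim: u => [|y u [c [[c0 c_step] c_le c_ge0]]] /=.
  by exists (fun=> 0%N); split=> // i; rewrite nth_nil mulr0.
have [y0 | y_neq0] := eqVneq y 0.
  exists (fun i => c i.-1); split=> [|//|[|i]] /=.
  - by split=> // -[|i] //=; rewrite leqnn leqnSn.
  - by rewrite y0 mulr0.
  - exact: c_ge0.
have y_ge0 : 0 <= (-1) ^+ ((y < 0)%R + 0)%N * y.
  by rewrite addn0; case: ltrP => y_sgn; rewrite ?mulN1r ?mul1r; lra.
have: forall i, u`_i != 0 -> u`_i \in [seq z <- u | z != 0].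
  move=> i ui; rewrite mem_filter ui mem_nth // ltnNge.
  by apply: contraNN ui => ?; rewrite nth_default.
have: forall z, z \in [seq z <- u | z != 0] -> z != 0.
  by move=> z; rewrite mem_filter => /andP[].
move: c_le c_ge0; case: [seq _ <- _ | _] => [|z s] /= c_le c_ge0 s_neq0 u_s.
  exists (fun=> 0%N); split=> // -[|i] //=.
  by have := u_s i; case: eqP => [->|_ /(_ isT)//]; rewrite mulr0.
have z_neq0 : z != 0 by rewrite s_neq0 ?mem_head.
(* The levels of the tail shift by one index, and rise by 1 if [y] and the next nonzero term [z]
   have opposite signs. *)
exists (fun i => if i is j.+1 then (y * z < 0)%R + c j else 0)%N; split=> [||i].
- by split=> // -[|i]; [rewrite c0; case: (_ < _) | have := c_step i; lia].
- by case=> [|i] //; rewrite /opposite_signs /= leq_add2l.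
case: i => [|i] //=; have := c_ge0 i; rewrite !exprD !mulrA.
suff -> : (-1) ^+ (z < 0)%R =
    (-1) ^+ (y < 0)%R * (-1) ^+ (y * z < 0)%R :> R by [].
rewrite -signr_addb; congr (_ ^+ nat_of_bool _).
by case: (ltgtP y 0) y_neq0 => // y0 _; case: (ltgtP z 0) z_neq0 => // z0 _ /=;
  rewrite ?(nmulr_rlt0 _ y0) ?(pmulr_rlt0 _ y0) ?z0 ?(lt_gtF z0).
Qed.

(** The pairs are the consecutive terms of [y :: s] followed by [z]; each change flips the sign, so
    the parity depends only on the ends. Taking [z = y] gives the cyclic count. *)
Lemma count_opposite_cycle (R : realFieldType) (y z : R) (s : seq R) :
    y != 0 -> z != 0 -> all (fun v => v != 0) s ->
  let m := count (@opposite_signs R) (zip (y :: s) (rcons s z)) in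
  (count (@opposite_signs R) (zip (y :: s) s) <= m)%N /\ odd m = (y * z < 0).
Proof.
move=> + z_neq0; elim: s y => [|v s IHs] y y_neq0 /=.
  by move=> _; rewrite /opposite_signs /= addn0; case: (_ < _).
case/andP=> v_neq0 /(IHs v v_neq0)/=[c_le c_odd]; split.
  by rewrite leq_add2l.
rewrite oddD c_odd /opposite_signs /= oddb.
by case: (ltgtP y 0) y_neq0 => // y0 _; case: (ltgtP v 0) v_neq0 => // v0 _;
  rewrite ?(nmulr_rlt0 _ y0) ?(pmulr_rlt0 _ y0) ?(nmulr_rlt0 _ v0)
    ?(pmulr_rlt0 _ v0) ?v0 ?(lt_gtF v0) //; case: (ltgtP z 0) z_neq0.
Qed.

Lemma cyclic_sign_changesP (R : realFieldType) (k : nat) (f : 'I_k -> R) :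
  (sign_changes f <= cyclic_sign_changes f)%N /\ ~~ odd (cyclic_sign_changes f).
Proof.
rewrite /sign_changes /cyclic_sign_changes /nonzero_terms.
have: all (fun y => y != 0) [seq y <- codom f | y != 0] by exact: filter_all.
case: [seq _ <- _ | _] => [|y s] //= /andP[y_neq0 s_neq0].
rewrite rot1_cons; have [-> ->] := count_opposite_cycle y_neq0 y_neq0 s_neq0.
by rewrite -leNgt -expr2 sqr_ge0.
Qed.

(** * Sign changes of an annihilating sequence *)

(** Tested on 1 and the coordinates, [f] is an affine dependence among all nodes. *)
Lemma annihilator_many_nodes (R : realFieldType) (d k : nat)
    (x : 'I_k -> 'rV[R]_d) (f : 'I_k -> R) :
    general_position x -> (exists i, f i != 0) ->
    (forall P : {mpoly R[d]}, (msize P <= 2)%N ->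
      \sum_(i < k) P.@[x i ord0] * f i = 0) ->
  (d.+1 < k)%N.
Proof.
move=> gp [i0 /eqP f_i0] f_ann; rewrite ltnNge; apply/negP => kd; apply: f_i0.
have sumT (V : zmodType) (F : 'I_k -> V) :
    \sum_(i in [set: 'I_k]) F i = \sum_i F i.
  by apply: eq_bigl => i; rewrite inE.
apply: (gp [set: 'I_k]) (in_setT i0); first by rewrite cardsT card_ord.
  rewrite sumT -[RHS](f_ann 1) ?msize1 //.
  by apply: eq_bigr => i _; rewrite meval1 mul1r.
apply/rowP => j; rewrite summxE mxE sumT.
rewrite -[RHS](f_ann 'X_j); last by rewrite msizeX mdeg1.
by apply: eq_bigr => i _; rewrite mevalXU mxE mulrC.
Qed.

Lemma annihilator_sign_changes (R : realFieldType) (d k n : nat) (closed : bool)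
    (x : 'I_k.+1 -> 'rV[R]_d) (f : 'I_k.+1 -> R) :
    embedded_line closed x -> convex_line closed x ->
    ((0 < n)%N -> general_position x /\ (d <= k)%N) ->
    (exists i, f i != 0) ->
    (forall P : {mpoly R[d]}, (msize P <= n.+1)%N ->
      \sum_(i < k.+1) P.@[x i ord0] * f i = 0) ->
  (d * n < sign_changes f)%N.
Proof.
move=> x_emb x_conv n_gt0 [i0 f_i0] f_ann; rewrite ltnNge; apply/negP => f_le.
have [c [[c0 c_step] c_le c_ge0]] := sign_levels (codom f).
(* The slice of [c] between heights [d * m] and [d * m.+1], which again climbs by unit steps. *)
pose cm m i := minn d (c i - d * m).
have [m m_lt | P P_size P_gt0] := @sign_pattern_prod _ _ _ n x cm.
  have [gp dk] := n_gt0 (leq_ltn_trans (leq0n _) m_lt).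
  apply: (sign_pattern_levels x_emb x_conv gp dk) => [|i]; last exact: geq_minl.
  by split=> [|i]; rewrite /cm ?c0; [lia | have := c_step i; lia].
move: c_ge0; set b := (head 0 _ < 0); rewrite /= => c_ge0.
have PE i : (\sum_(m < n) cm m (i : 'I_k.+1))%N = c i.
  rewrite sum_minn_subn; apply/minn_idPl; exact: leq_trans (c_le i) f_le.
have {}c_ge0 (i : 'I_k.+1) : 0 <= (-1) ^+ (b + c i)%N * f i.
  have := c_ge0 i; rewrite codomE (nth_map i0) ?size_enum_ord ?ltn_ord //.
  by rewrite nth_ord_enum.
(* Up to the common sign, the vanishing sum has nonnegative terms, so each is zero, although neither
   factor vanishes at [i0]. *)
have term_ge0 i : true -> 0 <= (-1) ^+ b * (P.@[x i ord0] * f i).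
  move=> _; have := mulr_ge0 (ltW (P_gt0 i)) (c_ge0 i).
  by rewrite PE addnC exprD -mulrA mulrACA -expr2 sqrr_sign mul1r mulrCA.
have /(psumr_eq0P term_ge0)/(_ i0 isT)/eqP :
    \sum_i (-1) ^+ b * (P.@[x i ord0] * f i) = 0.
  by rewrite -mulr_sumr f_ann ?mulr0.
rewrite !mulf_eq0 signr_eq0 (negPf f_i0) orbF.
by have := P_gt0 i0; case: eqP => // ->; rewrite mulr0 ltxx.
Qed.

Theorem theorem6 (R : realFieldType) (d k n : nat) (closed : bool)
    (x : 'I_k -> 'rV[R]_d) (f : 'I_k -> R)
    (x_embedded : embedded_line closed x)
    (x_convex : convex_line closed x)
    (x_general : (0 < n)%N -> general_position x)
    (f_neq0 : exists i, f i != 0)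
    (f_annihilates : forall P : {mpoly R[d]}, (msize P <= n.+1)%N ->
       \sum_(i < k) P.@[x i ord0] * f i = 0) :
  (~~ closed -> (d * n + 1 <= sign_changes f)%N) /\
  (closed -> (d * n + 2 <= cyclic_sign_changes f)%N).
Proof.
case: k x f x_embedded x_convex x_general f_neq0 f_annihilates
  => [|k] x f x_emb x_conv x_gen f_neq0 f_ann; first by case: f_neq0 => -[].
have x_gp : (0 < n)%N -> general_position x /\ (d <= k)%N.
  move=> n_gt0; split; first exact: x_gen.
  apply/ltnW/(annihilator_many_nodes (x_gen n_gt0) f_neq0) => P P_size.
  by apply: f_ann; apply: leq_trans P_size _.
have lt_changes := annihilator_sign_changes x_emb x_conv x_gp f_neq0 f_ann.
split=> [_ | closedT]; first by rewrite addn1.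
have [le_cyc even_cyc] := cyclic_sign_changesP f.
(* An even count above the even number [d * n] is at least [d * n + 2]. *)
suff: ~~ odd (d * n) by lia.
move: x_gp; case: (posnP n) => [-> | _ /(_ isT)[gp dk]]; first by rewrite muln0.
rewrite closedT in x_emb x_conv.
by rewrite oddM (negPf (closed_convex_line_even x_emb x_conv gp dk)).
Qed.
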